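(* Let $1<p<2$, let $K_1\subset\mathbb R^2$ be a fixed triangle with $0\in\overline{K_1}$, and let $\mathbf q\in L^p(K_1)^2$ satisfy the scaling identity $\mathbf q(tx)=t^{-1}\mathbf q(x)$ for $0<t\le1$ and a.e. $x\in K_1$, and let $\mathbf q$ be not identically zero on $K_1$. Then, for $0<h\le 1$, $$\inf_{\boldsymbol{\tau}_h\in\mathrm{RT}_0(hK_1)}\|\mathbf q-\boldsymbol{\tau}_h\|_{L^p(hK_1)}\simeq h^{2/p-1},$$ that is, there are constants $0<c\le C<\infty$ independent of $h$ such that the left-hand side lies between $c\,h^{2/p-1}$ and $C\,h^{2/p-1}$.
   Context: For a triangle $K$, $\mathrm{RT}_0(K)$ is the space of fields $x\mapsto\mathbf a+bx$ on $K$ with $\mathbf a\in\mathbb R^2$, $b\in\mathbb R$. $hK_1:=\{hx:\ x\in K_1\}$. *)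

(* Defs.v *)
From HB Require Import structures.
From mathcomp Require Import all_boot all_order all_algebra.
From mathcomp Require Import all_classical all_reals all_analysis.

Set Implicit Arguments.
Unset Strict Implicit.
Unset Printing Implicit Defensive.

Import Order.TTheory GRing.Theory Num.Theory.
Import numFieldNormedType.Exports.

Local Open Scope classical_set_scope.
Local Open Scope ring_scope.

Section PlaneFields.
Context {R : realType}.
Local Notation plane := (R * R)%type.
Implicit Types (x : plane) (K : set plane) (f : plane -> plane).

Definition lebesgue2 :
    {measure set (measurableTypeR R * measurableTypeR R) -> \bar R} :=
  (@lebesgue_measure R \x @lebesgue_measure R)%E.

(* The library norm on R * R is the sup norm. *)
Definition euclid_norm x : R := Num.sqrt (x.1 ^+ 2 + x.2 ^+ 2).

Definition affinely_independent (u v w : plane) : Prop :=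
  forall s t : R, s *: (v - u) + t *: (w - u) = 0 -> s = 0 /\ t = 0.

Definition open_triangle (u v w : plane) : set plane :=
  [set x | exists l m n : R, [/\ 0 < l, 0 < m, 0 < n, l + m + n = 1
                               & x = l *: u + m *: v + n *: w]].

Definition closed_triangle (u v w : plane) : set plane :=
  [set x | exists l m n : R, [/\ 0 <= l, 0 <= m, 0 <= n, l + m + n = 1
                               & x = l *: u + m *: v + n *: w]].

(* Nondegenerate; both conventions, open and closed, are allowed. *)
Definition is_triangle K : Prop :=
  exists u v w : plane, affinely_independent u v w /\
    (K = open_triangle u v w \/ K = closed_triangle u v w).

Definition dilate (h : R) K : set plane := [set h *: x | x in K].

(* Fields on K are represented by total functions; their values outside K
   are left unconstrained. *)
Definition RT0 K : set (plane -> plane) :=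
  [set tau | exists (a : plane) (b : R), forall x, K x -> tau x = a + b *: x].

Definition Lp_field (p : R) K f : Prop :=
  (fst \o f) \_ K \in Lfun lebesgue2 p%:E /\
  (snd \o f) \_ K \in Lfun lebesgue2 p%:E.

Definition Lp_norm (p : R) K f : \bar R :=
  Lnorm lebesgue2 p%:E (EFin \o ((euclid_norm \o f) \_ K)).

Definition RT0_error (p : R) K f : \bar R :=
  ereal_inf [set Lp_norm p K (fun x => f x - tau x) | tau in RT0 K].

End PlaneFields.

(* Main.v *)
Require Import Defs.
From HB Require Import structures.
From mathcomp Require Import all_boot all_order all_algebra.
From mathcomp Require Import all_classical all_reals all_analysis.
From mathcomp Require Import measurable_realfun ring lra.

Set Implicit Arguments.
Unset Strict Implicit.
Unset Printing Implicit Defensive.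

Import Order.TTheory GRing.Theory Num.Theory.
Import numFieldNormedType.Exports.

Local Open Scope classical_set_scope.
Local Open Scope ring_scope.

(** The error has an exact scaling law, and only its value at h = 1 has to be
  estimated.  Let K be the triangle.  Substituting x = h y and using q (h y) = h^-1 q y,

    || q - tau ||_(L^p(hK)) = h^(2/p - 1) || q - h tau (h .) ||_(L^p(K)),

  where h^(2/p) is the Jacobian factor of the plane and tau |-> h tau (h .)
  maps RT0 (hK) to RT0 K ([Lp_norm_dilate_homogeneous]).  Taking tau = 0 gives
  the upper bound with constant || q ||_(L^p(K)), which is finite.

  For the lower bound, q has to stay away from RT0 K.  Instead of the closedness
  of finite-dimensional subspaces, an explicit linear operator separates q from
  RT0 K:

    (D f)(x) = f(x) - 3 f(x/2) + 2 f(x/4).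

  Its weights are chosen so that D kills constants (1 - 3 + 2 = 0) and linear
  fields (1 - 3/2 + 2/4 = 0), hence all of RT0 K, while on a field which is
  homogeneous of degree -1 it acts as multiplication by 1 - 6 + 8 = 3.  So
  3 q = D (q - tau) for every tau in RT0 K, and since D is bounded on L^p(K),
  || q || <= M || q - tau || with M depending on p alone
  ([Lp_norm_le_RT0_distance]).  As || q || > 0, this is the lower bound.

  Both steps evaluate fields at t x with x in K and 0 < t <= 1.  This stays in
  K because a triangle is an intersection of three half planes and 0 belongs to
  its closure ([triangle_star_shaped]). *)

(** * Dilations of the plane *)

Section Dilation.
Context {R : realType}.
Local Notation mR := (measurableTypeR R).

(** Uniqueness of the Lebesgue measure: h times the image measure under
  multiplication by h gives each interval ]a, b] its length. *)
Lemma lebesgue_measure_dilation (h : R) (A : set mR) : 0 < h -> measurable A ->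
  lebesgue_measure A = (h%:E * lebesgue_measure (( *%R h : mR -> mR) @^-1` A))%E.
Proof.
move=> h0 mA.
have mh : measurable_fun [set: mR] ( *%R h : mR -> mR) by exact: mulrl_measurable.
pose k : {nonneg R} := NngNum (ltW h0).
pose nu : {measure set mR -> \bar R} :=
  mscale k (pushforward lebesgue_measure ( *%R h : mR -> mR)).
rewrite [LHS](@lebesgue_measure_unique _ (nu mh)) // => _ [[a b]] _ <-.
rewrite /nu /= /mscale /= /pushforward.
have -> : ( *%R h @^-1` `]a, b]%classic) = `](h^-1 * a), (h^-1 * b)]%classic.
  apply/seteqP; split => x /=; rewrite !in_itv /= ?[h^-1 * _]mulrC;
    by rewrite ltr_pdivrMr // ler_pdivlMr // mulrC.
rewrite !lebesgue_measure_itv /= !lte_fin ltr_pM2l ?invr_gt0//.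
case: ifP => _; last by rewrite mule0.
by rewrite !EFinN -!EFinD -EFinM; congr EFin; field; rewrite gt_eqF.
Qed.

Lemma measurable_scale2 (h : R) :
  measurable_fun [set: mR * mR] ((fun x : R * R => h *: x) : mR * mR -> mR * mR).
Proof.
apply: measurable_fun_pair.
  by apply: (measurableT_comp (mulrl_measurable h)); exact: measurable_fst.
by apply: (measurableT_comp (mulrl_measurable h)); exact: measurable_snd.
Qed.

Lemma lebesgue2_dilation (h : R) (X : set (mR * mR)) : 0 < h -> measurable X ->
  lebesgue2 X = ((h ^+ 2)%:E * lebesgue2 ((fun x : R * R => h *: x) @^-1` X))%E.
Proof.
move=> h0 mX.
have mh := measurable_scale2 h.
pose k : {nonneg R} := NngNum (ltW (exprn_gt0 2 h0)).
pose nu : {measure set (mR * mR) -> \bar R} :=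
  mscale k (pushforward lebesgue2 ((fun x : R * R => h *: x) : mR * mR -> mR * mR)).
rewrite [LHS](@product_measure_unique _ _ _ _ _ _ _ (nu mh)) // => A B mA mB.
rewrite /nu /= /mscale /= /pushforward.
have -> : (fun x : R * R => h *: x) @^-1` (A `*` B) =
   ( *%R h @^-1` A) `*` ( *%R h @^-1` B) by [].
rewrite product_measure1E; last 2 first.
- by rewrite -[X in measurable X]setTI; apply: mulrl_measurable.
- by rewrite -[X in measurable X]setTI; apply: mulrl_measurable.
rewrite (lebesgue_measure_dilation h0 mA) (lebesgue_measure_dilation h0 mB).
by rewrite muleACA -EFinM -expr2.
Qed.

Lemma integral_dilation (h : R) (f : mR * mR -> \bar R) : 0 < h ->
  measurable_fun [set: mR * mR] f -> (forall x, 0 <= f x)%E ->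
  (\int[lebesgue2]_x f x = (h ^+ 2)%:E * \int[lebesgue2]_x f (h *: (x : R * R)))%E.
Proof.
move=> h0 mf f0.
have mh := measurable_scale2 h.
pose k : {nonneg R} := NngNum (ltW (exprn_gt0 2 h0)).
pose nu : {measure set (mR * mR) -> \bar R} :=
   pushforward lebesgue2 ((fun x : R * R => h *: x) : mR * mR -> mR * mR).
transitivity (\int[mscale k (nu mh)]_x f x)%E.
  by apply: eq_measure_integral => X mX _; exact: lebesgue2_dilation.
have E1 := @ge0_integral_mscale _ _ _ (nu mh) setT measurableT k f mf
  (fun x _ => f0 x).
have E2 := @ge0_integral_pushforward _ _ _ _ _ _ mh lebesgue2 setT f
  measurableT mf (fun x _ => f0 x).
by rewrite E1; exact: (congr1 (fun z => (h ^+ 2)%:E * z)%E E2).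
Qed.

(** This is both the source of the factor h^(2/p) in the scaling law and the
  boundedness of f |-> f (t .) on L^p, used for t = 1/2 and t = 1/4. *)
Lemma Lnorm_dilation (p h : R) (f : mR * mR -> \bar R) : 0 < p -> 0 < h ->
  measurable_fun [set: mR * mR] f ->
  (Lnorm lebesgue2 p%:E (fun x : R * R => f (h *: x)%R) =
   (h `^ - (2 / p))%:E * Lnorm lebesgue2 p%:E f)%E.
Proof.
move=> p0 h0 mf; rewrite unlock.
rewrite (@integral_dilation h (fun x => `|f x| `^ p)%E) //; last first.
- by move=> x; exact: poweR_ge0.
- apply: (@measurableT_comp _ _ _ _ _ _ (fun x => x `^ p)%E) => //=.
    exact: measurable_poweR.
  exact: measurableT_comp.
rewrite poweRM ?lee_fin ?exprn_ge0 ?integral_ge0 //; last 2 first.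
- exact: ltW.
- by move=> x _; exact: poweR_ge0.
rewrite poweR_EFin muleA -EFinM.
suff -> : h `^ (- (2 / p)) * (h ^+ 2) `^ p^-1 = 1 by rewrite mul1e.
rewrite -powR_mulrn ?ltW// -powRrM -powRD ?addNr ?powRr0 //.
by rewrite (gt_eqF h0) implybT.
Qed.

End Dilation.

(** * Triangles as intersections of half planes *)

Section Triangles.
Context {R : realType}.
Local Notation mR := (measurableTypeR R).
Implicit Types (f : R * R -> R) (K : set (R * R)).

Definition affine_form f : Prop :=
  exists a b c : R, forall x, f x = a + b * x.1 + c * x.2.

Lemma affine_form_continuous f : affine_form f -> continuous f.
Proof.
move=> [a [b [c fE]]]; have -> : f = (fun x => a + b * x.1 + c * x.2).
  exact/funext.
move=> x; apply: cvgD; first apply: cvgD.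
- exact: cvg_cst.
- by apply: cvgM; [exact: cvg_cst|exact: cvg_fst].
- by apply: cvgM; [exact: cvg_cst|exact: cvg_snd].
Qed.

Lemma affine_form_measurable f : affine_form f ->
  measurable_fun [set: mR * mR] (f : mR * mR -> mR).
Proof.
move=> [a [b [c fE]]]; have -> : f = (fun x => a + b * x.1 + c * x.2).
  exact/funext.
apply: measurable_funD; first apply: measurable_funD => //.
  by apply: measurable_funM => //; exact: measurable_fst.
by apply: measurable_funM => //; exact: measurable_snd.
Qed.

Lemma affine_form_scale f (t : R) x : affine_form f ->
  f (t *: x) = t * f x + (1 - t) * f 0.
Proof. by move=> [a [b [c fE]]]; rewrite !fE /= /GRing.scale /=; ring. Qed.

(** If the determinant vanished, the second coordinates of v - u and w - u
  would supply the coefficients of a linear relation between these vectors, and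
  so would the first ones; independence then makes all of them vanish, so v = u,
  which is absurd. *)
Lemma affinely_independent_det (u v w : R * R) : affinely_independent u v w ->
  (v.1 - u.1) * (w.2 - u.2) - (v.2 - u.2) * (w.1 - u.1) != 0.
Proof.
move=> uvw; apply/eqP => d0.
have pairE (a b : R) : a = 0 -> b = 0 -> (a, b) = 0 :> R * R by move=> -> ->.
have [wu2 /eqP] : w.2 - u.2 = 0 /\ - (v.2 - u.2) = 0.
  by apply: uvw; apply: pairE; rewrite /= /GRing.scale /=; [rewrite -d0|]; ring.
rewrite oppr_eq0 => /eqP vu2.
have [/eqP + vu1] : - (w.1 - u.1) = 0 /\ v.1 - u.1 = 0.
  by apply: uvw; apply: pairE; rewrite /= /GRing.scale /= ?vu2 ?wu2; ring.
rewrite oppr_eq0 => /eqP wu1.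
have [/eqP] : (1 : R) = 0 /\ (0 : R) = 0; last by rewrite oner_eq0.
by apply: uvw; apply: pairE; rewrite /= /GRing.scale /= ?vu1 ?vu2; ring.
Qed.

(** The three forms are the barycentric coordinates, given by Cramer's rule.
  Open and closed triangles differ only in the strictness of the
  inequalities, so that the two conventions can be treated together. *)
Lemma triangle_half_planes K : is_triangle K ->
  exists l m n : R * R -> R,
  [/\ affine_form l, affine_form m, affine_form n &
      K = [set x | [/\ 0 < l x, 0 < m x & 0 < n x]] \/
      K = [set x | [/\ 0 <= l x, 0 <= m x & 0 <= n x]]].
Proof.
move=> [[u1 u2] [[v1 v2] [[w1 w2] [/affinely_independent_det /= d0 KE]]]].
set d := (X in X != 0) in d0.
pose m (x : R * R) := ((x.1 - u1) * (w2 - u2) - (x.2 - u2) * (w1 - u1)) / d.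
pose n (x : R * R) := ((v1 - u1) * (x.2 - u2) - (v2 - u2) * (x.1 - u1)) / d.
pose l x := 1 - m x - n x.
have am : affine_form m.
  exists ((u2 * (w1 - u1) - u1 * (w2 - u2)) / d), ((w2 - u2) / d),
    (- (w1 - u1) / d) => x.
  by rewrite /m; field.
have an : affine_form n.
  exists ((u1 * (v2 - u2) - u2 * (v1 - u1)) / d), (- (v2 - u2) / d),
    ((v1 - u1) / d) => x.
  by rewrite /n; field.
have al : affine_form l.
  case: am an => [a [b [c mE]]] [a' [b' [c' nE]]].
  by exists (1 - a - a'), (- b - b'), (- c - c') => x; rewrite /l mE nE; ring.
have lmn x : x = l x *: (u1, u2) + m x *: (v1, v2) + n x *: (w1, w2).
  case: x => x1 x2; congr pair; rewrite /l /m /n /= /GRing.scale /=;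
    by rewrite /d; field.
have mn0 (r s t : R) : r + s + t = 1 ->
    let x := r *: (u1, u2) + s *: (v1, v2) + t *: (w1, w2) in
    [/\ l x = r, m x = s & n x = t].
  move=> /(canRL (addrK _)) /(canRL (addrK _)) -> /=.
  by rewrite /l /m /n /= /GRing.scale /=; split; rewrite /d; field.
exists l, m, n; split => //.
case: KE => ->; [left|right]; apply/seteqP; split => x /=.
- by move=> [r [s [t [r0 s0 t0 /mn0 /= [lE mE nE] ->]]]]; rewrite lE mE nE.
- by move=> [l0 m0 n0]; exists (l x), (m x), (n x); split; rewrite /l //; ring.
- by move=> [r [s [t [r0 s0 t0 /mn0 /= [lE mE nE] ->]]]]; rewrite lE mE nE.
- by move=> [l0 m0 n0]; exists (l x), (m x), (n x); split; rewrite /l //; ring.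
Qed.

Lemma triangle_measurable K : is_triangle K -> measurable (K : set (mR * mR)).
Proof.
move=> /triangle_half_planes[l [m [n [al am an]]]].
have pos f : affine_form f -> measurable ([set x | 0 < f x] : set (mR * mR)).
  move=> /affine_form_measurable mf; rewrite -[X in measurable X]setTI.
  have -> : [set x | 0 < f x] = f @^-1` `]0, +oo[%classic.
    by apply/seteqP; split => x /=; rewrite in_itv /= andbT.
  exact: mf.
have nneg f : affine_form f -> measurable ([set x | 0 <= f x] : set (mR * mR)).
  move=> /affine_form_measurable mf; rewrite -[X in measurable X]setTI.
  have -> : [set x | 0 <= f x] = f @^-1` `[0, +oo[%classic.
    by apply/seteqP; split => x /=; rewrite in_itv /= andbT.
  exact: mf.
case=> ->.
- have -> : [set x | [/\ 0 < l x, 0 < m x & 0 < n x]] =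
      [set x | 0 < l x] `&` [set x | 0 < m x] `&` [set x | 0 < n x].
    by apply/seteqP; split => x /=; [case|case; case].
  by apply: measurableI; [apply: measurableI|]; exact: pos.
- have -> : [set x | [/\ 0 <= l x, 0 <= m x & 0 <= n x]] =
      [set x | 0 <= l x] `&` [set x | 0 <= m x] `&` [set x | 0 <= n x].
    by apply/seteqP; split => x /=; [case|case; case].
  by apply: measurableI; [apply: measurableI|]; exact: nneg.
Qed.

Lemma affine_form_closure_ge0 f K x : affine_form f ->
  (forall y, K y -> 0 <= f y) -> closure K x -> 0 <= f x.
Proof.
move=> /affine_form_continuous cf f0 Kx.
have cl : closed (f @^-1` [set r | 0 <= r]).
  by apply: preimage_closed => //; exact: closed_ge.
apply: (cl x); apply: closure_subset Kx; exact: f0.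
Qed.

(** A barycentric coordinate f satisfies f (t x) = t f x + (1 - t) f 0, and
  f 0 >= 0 as 0 is in the closure; so f (t x) inherits the sign of f x, strict
  or not, because t > 0. *)
Lemma triangle_star_shaped K x (t : R) : is_triangle K -> closure K (0 : R * R) ->
  0 < t -> t <= 1 -> K x -> K (t *: x).
Proof.
move=> /triangle_half_planes[l [m [n [al am an]]]] KE K0 t0 t1 Kx.
have t1' : 0 <= 1 - t by rewrite subr_ge0.
have f0 f : affine_form f -> (forall y, K y -> 0 <= f y) -> 0 <= (1 - t) * f 0.
  by move=> af fK; rewrite mulr_ge0 // (affine_form_closure_ge0 af fK).
have [l0 m0 n0] : [/\ 0 <= (1 - t) * l 0, 0 <= (1 - t) * m 0 &
    0 <= (1 - t) * n 0].
  by split; apply: f0 => // y; case: KE => -> /= [] // *; exact: ltW.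
case: KE Kx => -> /= [lx mx nx]; split; rewrite affine_form_scale //.
- by rewrite ltr_wpDr // mulr_gt0.
- by rewrite ltr_wpDr // mulr_gt0.
- by rewrite ltr_wpDr // mulr_gt0.
- by rewrite addr_ge0 // mulr_ge0 // ltW.
- by rewrite addr_ge0 // mulr_ge0 // ltW.
- by rewrite addr_ge0 // mulr_ge0 // ltW.
Qed.

End Triangles.

(** * The Euclidean norm of the plane *)

Section EuclideanNorm.
Context {R : realType}.
Local Notation mR := (measurableTypeR R).
Implicit Types x y : R * R.

Lemma euclid_norm_ge0 x : 0 <= euclid_norm x.
Proof. exact: sqrtr_ge0. Qed.

Lemma sqr_euclid_norm x : euclid_norm x ^+ 2 = x.1 ^+ 2 + x.2 ^+ 2.
Proof. by rewrite sqr_sqrtr // addr_ge0 // sqr_ge0. Qed.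

Lemma euclid_normD x y : euclid_norm (x + y) <= euclid_norm x + euclid_norm y.
Proof.
rewrite -ler_sqr ?nnegrE ?addr_ge0 ?euclid_norm_ge0 //.
rewrite sqrrD !sqr_euclid_norm /=.
(* Cauchy-Schwarz, by Lagrange's identity *)
suff : x.1 * y.1 + x.2 * y.2 <= euclid_norm x * euclid_norm y by move=> ?; lra.
have [/ltW s0|s0] := ltP (x.1 * y.1 + x.2 * y.2) 0.
  by rewrite (le_trans s0) // mulr_ge0 // euclid_norm_ge0.
rewrite -ler_sqr ?nnegrE ?mulr_ge0 ?euclid_norm_ge0 //.
rewrite exprMn !sqr_euclid_norm -subr_ge0.
have -> : (x.1 ^+ 2 + x.2 ^+ 2) * (y.1 ^+ 2 + y.2 ^+ 2) -
  (x.1 * y.1 + x.2 * y.2) ^+ 2 = (x.1 * y.2 - x.2 * y.1) ^+ 2 by ring.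
exact: sqr_ge0.
Qed.

Lemma euclid_normZ (c : R) x : euclid_norm (c *: x) = `|c| * euclid_norm x.
Proof.
rewrite /euclid_norm /= -sqrtr_sqr -sqrtrM ?sqr_ge0 //; congr Num.sqrt.
by rewrite /GRing.scale /=; ring.
Qed.

(** The L^p hypothesis on a field bears on its components; this transfers
  finiteness to its Euclidean norm. *)
Lemma euclid_norm_le x : euclid_norm x <= `|x.1| + `|x.2|.
Proof.
rewrite -ler_sqr ?nnegrE ?addr_ge0 ?euclid_norm_ge0 //.
rewrite sqr_euclid_norm sqrrD !real_normK ?num_real //.
by rewrite lerD2r lerDl mulrn_wge0 // mulr_ge0.
Qed.

Lemma euclid_norm_eq0 x : euclid_norm x = 0 -> x = 0.
Proof.
move=> /(congr1 (fun r => r ^+ 2)); rewrite sqr_euclid_norm expr0n /= => /eqP.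
rewrite paddr_eq0 ?sqr_ge0 // !sqrf_eq0 => /andP[/eqP x1 /eqP x2].
by case: x x1 x2 => /= a b -> ->.
Qed.

Lemma measurable_euclid_norm :
  measurable_fun [set: mR * mR] (euclid_norm : mR * mR -> mR).
Proof.
have -> : euclid_norm = (fun r => r `^ 2^-1) \o (fun x => x.1 ^+ 2 + x.2 ^+ 2)
    :> (R * R -> R).
  by apply/funext => x /=; rewrite powR12_sqrt // addr_ge0 // sqr_ge0.
apply: (measurableT_comp (measurable_powR 2^-1)).
apply: measurable_funD; apply: measurable_funX.
  exact: measurable_fst.
exact: measurable_snd.
Qed.

End EuclideanNorm.

(** * Almost everywhere comparison of L^p norms *)

Section LebesgueNorm.
Context d (T : measurableType d) (R : realType).
Context (mu : {measure set T -> \bar R}) (p : R) (p0 : 0 < p).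

Lemma measurable_abse_poweR (f : T -> \bar R) : measurable_fun [set: T] f ->
  measurable_fun [set: T] (fun x => `|f x| `^ p)%E.
Proof.
move=> mf; apply: (@measurableT_comp _ _ _ _ _ _ (fun x => x `^ p)%E) => //=.
  exact: measurable_poweR.
exact: measurableT_comp.
Qed.

Lemma ae_le_Lnorm (f g : T -> R) :
  measurable_fun [set: T] f -> measurable_fun [set: T] g ->
  {ae mu, forall x, `|f x| <= `|g x|} ->
  (Lnorm mu p%:E (EFin \o f) <= Lnorm mu p%:E (EFin \o g))%E.
Proof.
move=> mf mg fg; rewrite unlock.
have mf' := measurable_abse_poweR ((measurable_EFinP _ _).2 mf).
have mg' := measurable_abse_poweR ((measurable_EFinP _ _).2 mg).
have int0 (u : T -> R) :
    (\int[mu]_x `|(EFin \o u) x| `^ p \in `[0, +oo])%E.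
  by rewrite in_itv /= leey andbT integral_ge0 // => x _; exact: poweR_ge0.
apply: gt0_ler_poweR; [by rewrite invr_ge0 ltW|exact: int0|exact: int0|].
apply: ae_ge0_le_integral => //; try by move=> x _; exact: poweR_ge0.
apply: filterS fg => x fg _ /=.
by rewrite lee_fin ge0_ler_powR ?nnegrE // ltW.
Qed.

Lemma ae_eq_Lnorm (f g : T -> R) :
  measurable_fun [set: T] f -> measurable_fun [set: T] g ->
  {ae mu, forall x, f x = g x} ->
  Lnorm mu p%:E (EFin \o f) = Lnorm mu p%:E (EFin \o g).
Proof.
move=> mf mg fg; apply/eqP; rewrite eq_le; apply/andP; split.
  by apply: ae_le_Lnorm => //; apply: filterS fg => x ->.
by apply: ae_le_Lnorm => //; apply: filterS fg => x ->.
Qed.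

Lemma Lnorm_scale (c : R) (f : T -> R) : measurable_fun [set: T] f -> 0 <= c ->
  (Lnorm mu p%:E (EFin \o (fun x => c * f x)%R) =
   c%:E * Lnorm mu p%:E (EFin \o f))%E.
Proof.
move=> mf c0; rewrite unlock.
have mf' := measurable_abse_poweR ((measurable_EFinP _ _).2 mf).
under eq_integral => x _.
  rewrite /= normrM (ger0_norm c0) powRM // EFinM.
  over.
rewrite /= ge0_integralZl_EFin //; last exact: powR_ge0.
rewrite poweRM ?lee_fin ?powR_ge0 ?integral_ge0 //.
by rewrite poweR_EFin -powRrM divff ?gt_eqF // powRr1.
Qed.

End LebesgueNorm.

(** * Vector fields on a subset of the plane *)

Section Fields.
Context {R : realType}.
Local Notation mR := (measurableTypeR R).
Local Notation field := (mR * mR -> mR * mR).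
Implicit Types (K : set (R * R)) (f g q tau : R * R -> R * R).

(** Null sets of [lebesgue2] live in a product of measurable types, whereas
  the predicates on fields are over [R * R]: naming the filter lets the two
  descriptions of the plane be identified by conversion. *)
Let ae2_filter : Filter (almost_everywhere (@lebesgue2 R)) :=
  ae_filter_ringOfSetsType lebesgue2.

Definition star_shaped0 K : Prop :=
  forall (t : R) x, 0 < t -> t <= 1 -> K x -> K (t *: x).

(** Outside K the field is arbitrary, so measurability passes through the
  extension of each component by zero. *)
Lemma measurable_field K f : measurable (K : set (mR * mR)) ->
  measurable_fun (K : set (mR * mR)) (fst \o f : mR * mR -> mR) ->
  measurable_fun (K : set (mR * mR)) (snd \o f : mR * mR -> mR) ->
  measurable_fun (K : set (mR * mR)) (f : field).
Proof.
move=> mK /(measurable_restrictT _ mK) m1 /(measurable_restrictT _ mK) m2.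
apply: (@eq_measurable_fun _ _ _ _ _
  (fun x => (((fst \o f) \_ K) x, ((snd \o f) \_ K) x) : mR * mR)).
  by move=> x xK; rewrite /= !patchE xK /=; case: (f x).
by apply: measurable_funTS; exact: measurable_fun_pair.
Qed.

Lemma measurable_field_comp K f : measurable_fun (K : set (mR * mR)) (f : field) ->
  measurable_fun (K : set (mR * mR)) (fst \o f : mR * mR -> mR) /\
  measurable_fun (K : set (mR * mR)) (snd \o f : mR * mR -> mR).
Proof.
move=> mf; split; apply: measurableT_comp => //.
Qed.

Lemma RT0_measurable K tau : measurable (K : set (mR * mR)) -> RT0 K tau ->
  measurable_fun (K : set (mR * mR)) (tau : field).
Proof.
move=> mK [a [b tauE]].
apply: (@eq_measurable_fun _ _ _ _ _ ((fun x => a + b *: x) : field)).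
  by move=> x /set_mem /tauE ->.
apply: measurable_field => //; apply: measurable_funTS.
  apply: affine_form_measurable.
  by exists a.1, b, 0 => x; rewrite /= mul0r addr0.
apply: affine_form_measurable.
by exists a.2, 0, b => x; rewrite /= mul0r addr0.
Qed.

Lemma RT0_dilate (h : R) K tau : RT0 (dilate h K) tau ->
  RT0 K (fun x => h *: tau (h *: x)).
Proof.
move=> [a [b tauE]]; exists (h *: a), (h * b * h) => x Kx.
by rewrite tauE ?scalerDr ?scalerA //; exists x.
Qed.

Lemma measurable_fieldB K f g : measurable (K : set (mR * mR)) ->
  measurable_fun (K : set (mR * mR)) (f : field) ->
  measurable_fun (K : set (mR * mR)) (g : field) ->
  measurable_fun (K : set (mR * mR)) ((fun x => f x - g x) : field).
Proof.
move=> mK /measurable_field_comp[f1 f2] /measurable_field_comp[g1 g2].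
apply: measurable_field => //.
  exact: (measurable_funB f1 g1).
exact: (measurable_funB f2 g2).
Qed.

Lemma measurable_norm_field K f : measurable (K : set (mR * mR)) ->
  measurable_fun (K : set (mR * mR)) (f : field) ->
  measurable_fun [set: mR * mR] (((euclid_norm \o f) \_ K) : mR * mR -> mR).
Proof.
move=> mK mf; apply/(measurable_restrictT _ mK).
exact: (measurableT_comp measurable_euclid_norm).
Qed.

Lemma mem_dilate (h : R) K x : h != 0 -> (h *: x \in dilate h K) = (x \in K).
Proof.
move=> h0; apply/idP/idP => /set_mem.
  by move=> [y Ky /(scalerI h0) <-]; exact/mem_set.
by move=> Kx; apply/mem_set; exists x.
Qed.

Lemma dilate_measurable (h : R) K : h != 0 -> measurable (K : set (mR * mR)) ->
  measurable (dilate h K : set (mR * mR)).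
Proof.
move=> h0 mK.
have -> : dilate h K = (fun x => h^-1 *: x) @^-1` K.
  apply/seteqP; split => x /=; first by move=> [y Ky <-]; rewrite scalerK.
  by move=> Kx; exists (h^-1 *: x) => //; rewrite scalerKV.
by rewrite -[X in measurable X]setTI; apply: (measurable_scale2 h^-1).
Qed.

Lemma Lp_norm_dilate (p h : R) K f : 0 < p -> 0 < h ->
  measurable (K : set (mR * mR)) ->
  measurable_fun (dilate h K : set (mR * mR)) (f : field) ->
  Lp_norm p (dilate h K) f =
  ((h `^ (2 / p))%:E * Lp_norm p K (fun x => f (h *: x)))%E.
Proof.
move=> p0 h0 mK mf; have h0' : h != 0 by rewrite gt_eqF.
have mhK := dilate_measurable h0' mK.
rewrite /Lp_norm.
have -> : EFin \o ((euclid_norm \o (fun x => f (h *: x))) \_ K) =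
    (fun x => (EFin \o ((euclid_norm \o f) \_ (dilate h K))) (h *: x)).
  by apply/funext => x /=; rewrite !patchE mem_dilate.
rewrite Lnorm_dilation //; last first.
  by apply/measurable_EFinP; exact: measurable_norm_field.
by rewrite muleA -EFinM -powRD ?subrr ?powRr0 ?mul1e // h0' implybT.
Qed.

(** * The scaling law and the distance to RT0 *)

Lemma dilate_subset (h : R) K : star_shaped0 K -> 0 < h -> h <= 1 ->
  dilate h K `<=` K.
Proof. by move=> sK h0 h1 _ [x Kx <-]; exact: sK. Qed.

(** The homogeneity of q turns the approximation problem on hK into the one on
  K: q (h x) - tau (h x) = h^-1 (q x - h tau (h x)) almost everywhere, and h^-1
  lowers the Jacobian exponent 2/p by one. *)
Lemma Lp_norm_dilate_homogeneous (p h : R) K q tau : 0 < p -> 0 < h -> h <= 1 ->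
  measurable (K : set (mR * mR)) -> star_shaped0 K ->
  measurable_fun (K : set (mR * mR)) (q : field) ->
  {ae (@lebesgue2 R), forall x : R * R, K x -> q (h *: x) = h^-1 *: q x} ->
  RT0 (dilate h K) tau ->
  Lp_norm p (dilate h K) (fun x => q x - tau x) =
  ((h `^ (2 / p - 1))%:E *
    Lp_norm p K (fun x => q x - h *: tau (h *: x))%R)%E.
Proof.
move=> p0 h0 h1 mK sK mq qh tauRT; have h0' : h != 0 by rewrite gt_eqF.
have mhK := dilate_measurable h0' mK.
have hKK := dilate_subset sK h0 h1.
have mqt : measurable_fun (dilate h K : set (mR * mR))
    ((fun x => q x - tau x) : field).
  apply: measurable_fieldB => //; first exact: (measurable_funS _ hKK).
  exact: RT0_measurable.
have sRT := RT0_dilate tauRT.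
have mqs : measurable_fun (K : set (mR * mR))
    ((fun x => q x - h *: tau (h *: x)) : field).
  by apply: measurable_fieldB => //; exact: RT0_measurable.
rewrite Lp_norm_dilate // powRB ?powRr1 ?(ltW h0) //; last by rewrite h0' implybT.
rewrite EFinM -muleA; congr (_ * _)%E.
rewrite /Lp_norm -Lnorm_scale ?invr_ge0 ?(ltW h0) //; last first.
  exact: measurable_norm_field.
apply: ae_eq_Lnorm => //.
- have -> : (euclid_norm \o (fun x => q (h *: x) - tau (h *: x))) \_ K =
     (euclid_norm \o (fun x => q x - tau x)) \_ (dilate h K) \o
       (fun x => h *: x).
    by apply/funext => x /=; rewrite !patchE mem_dilate.
  apply: (measurableT_comp _ (measurable_scale2 h)).
  exact: measurable_norm_field.
- by apply: measurable_funM => //; exact: measurable_norm_field.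
apply: (@filterS _ _ ae2_filter _ _ _ qh) => x qhx; rewrite !patchE.
case: ifPn => [/set_mem Kx|_] /=; last by rewrite mulr0.
rewrite (qhx Kx) -[h^-1 in RHS]ger0_norm ?invr_ge0 ?(ltW h0) // -euclid_normZ.
by rewrite scalerBr scalerA mulVf // scale1r.
Qed.

(** With g = |q - tau|, the identity 3 q = D (q - tau) gives
  3 |q x| <= g x + 3 g (x/2) + 2 g (x/4), hence
  |q x| <= g x + g (x/2) + g (x/4).  The constant is the sum of the norms on
  L^p of the three dilations. *)
Lemma Lp_norm_le_RT0_distance (p : R) K q tau : 1 <= p ->
  measurable (K : set (mR * mR)) -> star_shaped0 K ->
  measurable_fun (K : set (mR * mR)) (q : field) ->
  (forall t : R, 0 < t -> t <= 1 ->
     {ae (@lebesgue2 R), forall x : R * R, K x -> q (t *: x) = t^-1 *: q x}) ->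
  RT0 K tau ->
  (Lp_norm p K q <= (1 + 2^-1 `^ (- (2 / p)) + 4^-1 `^ (- (2 / p)))%:E *
    Lp_norm p K (fun x => q x - tau x)%R)%E.
Proof.
move=> p1 mK sK mq qt tauRT; have p0 : 0 < p by exact: lt_le_trans p1.
have mqt : measurable_fun (K : set (mR * mR)) ((fun x => q x - tau x) : field).
  by apply: measurable_fieldB => //; exact: RT0_measurable.
rewrite /Lp_norm; set Q := _ \_ K; set g := (_ \o (fun x => _)) \_ K.
have mQ : measurable_fun [set: mR * mR] (Q : mR * mR -> mR).
  exact: measurable_norm_field.
have mg : measurable_fun [set: mR * mR] (g : mR * mR -> mR).
  exact: measurable_norm_field.
have mgt (t : R) : measurable_fun [set: mR * mR]
    ((fun x => g (t *: (x : R * R))) : mR * mR -> mR).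
  exact: (measurableT_comp mg (measurable_scale2 t)).
have g0 x : 0 <= g x.
  by rewrite /g patchE; case: ifP => //= _; exact: euclid_norm_ge0.
have h0 : (0 : R) < 2^-1 by lra.
have h1 : (2^-1 : R) <= 1 by lra.
have k0 : (0 : R) < 4^-1 by lra.
have k1 : (4^-1 : R) <= 1 by lra.
have Qg : {ae (@lebesgue2 R), forall x : R * R,
    `|Q x| <= `|g x + (g (2^-1 *: x) + g (4^-1 *: x))|}.
  apply: (@filterS2 _ _ ae2_filter _ _ _ _ (qt _ h0 h1) (qt _ k0 k1)) => x qh qk.
  rewrite [leRHS]ger0_norm ?addr_ge0 //.
  rewrite {1}/Q patchE; case: ifPn => [/set_mem Kx|_]; last first.
    by rewrite normr0 !addr_ge0.
  have Khx := sK _ _ h0 h1 Kx; have Kkx := sK _ _ k0 k1 Kx.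
  have gE y : K y -> g y = euclid_norm (q y - tau y).
    by move=> Ky; rewrite /g patchE mem_set.
  rewrite /= ger0_norm ?euclid_norm_ge0 //.
  (* 1 - 3 + 2 = 0 and 1 - 3/2 + 2/4 = 0 cancel tau; 1 - 3 * 2 + 2 * 4 = 3 *)
  have q3 : 3 *: q x = (q x - tau x) +
     (- 3 *: (q (2^-1 *: x) - tau (2^-1 *: x)) +
      2 *: (q (4^-1 *: x) - tau (4^-1 *: x))).
    rewrite qh // qk //; case: tauRT => a [b tauE]; rewrite !tauE //.
    case: (q x) => q1 q2; case: a {tauE} => a1 a2; case: (x) => x1 x2.
    by congr pair; rewrite /= /GRing.scale /=; field.
  have := euclid_normZ 3 (q x); rewrite {1}q3.
  set A := q x - _; set B := _ - tau (2^-1 *: x); set D := _ - tau (4^-1 *: x).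
  have := euclid_normD A (- 3 *: B + 2 *: D).
  have := euclid_normD (- 3 *: B) (2 *: D).
  rewrite !euclid_normZ normrN !normr_nat !gE // -/A -/B -/D.
  by have := euclid_norm_ge0 A; have := euclid_norm_ge0 D; lra.
apply: (le_trans (ae_le_Lnorm p0 mQ _ Qg)).
  exact: (measurable_funD mg (measurable_funD (mgt _) (mgt _))).
have p1' : (1 <= p%:E)%E by rewrite lee_fin.
apply: (le_trans (eminkowski _ mg (measurable_funD (mgt _) (mgt _)) p1')).
have LgE (t : R) : 0 < t -> Lnorm lebesgue2 p%:E
    (EFin \o (fun x => g (t *: (x : R * R)))) =
    ((t `^ - (2 / p))%:E * Lnorm lebesgue2 p%:E (EFin \o g))%E.
  move=> t0; rewrite -Lnorm_dilation //.
  exact/measurable_EFinP.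
rewrite -addrA EFinD ge0_muleDl ?lee_fin ?addr_ge0 ?powR_ge0 // mul1e.
rewrite leeD2l // EFinD ge0_muleDl ?lee_fin ?powR_ge0 //.
by rewrite -!LgE //; exact: (eminkowski _ (mgt _) (mgt _) p1').
Qed.

Lemma Lp_field_measurable (p : R) K q : measurable (K : set (mR * mR)) ->
  Lp_field p K q -> measurable_fun (K : set (mR * mR)) (q : field).
Proof.
move=> mK [/sub_Lfun_mfun q1 /sub_Lfun_mfun q2].
apply: measurable_field => //; apply/(measurable_restrictT _ mK).
- by move: q1; rewrite inE.
- by move: q2; rewrite inE.
Qed.

Lemma Lp_field_norm_lty (p : R) K q : 1 <= p -> measurable (K : set (mR * mR)) ->
  Lp_field p K q -> (Lp_norm p K q < +oo)%E.
Proof.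
move=> p1 mK qLp; have p0 : 0 < p by exact: lt_le_trans p1.
have mq := Lp_field_measurable mK qLp.
have [m1 m2] := measurable_field_comp mq.
move: m1 m2 => /(measurable_restrictT _ mK) m1 /(measurable_restrictT _ mK) m2.
case: qLp => /sub_Lfun_finLfun /set_mem q1 /sub_Lfun_finLfun /set_mem q2.
have n1 := measurableT_comp (@normr_measurable R setT) m1.
have n2 := measurableT_comp (@normr_measurable R setT) m2.
apply: (@le_lt_trans _ _ (Lnorm lebesgue2 p%:E (EFin \o
  ((Num.norm \o ((fst \o q) \_ K)) \+ (Num.norm \o ((snd \o q) \_ K)))))).
  apply: ae_le_Lnorm => //.
  - exact: measurable_norm_field.
  - exact: measurable_funD.
  apply: aeW => x /=; rewrite !patchE; case: ifPn => _; last first.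
    by rewrite normr0.
  rewrite /= ger0_norm ?euclid_norm_ge0 // ger0_norm ?addr_ge0 //.
  exact: euclid_norm_le.
apply: le_lt_trans (eminkowski _ n1 n2 _) _; first by rewrite lee_fin.
have normE (f : R * R -> R) : Lnorm lebesgue2 p%:E (EFin \o (Num.norm \o f)) =
    Lnorm lebesgue2 p%:E (EFin \o f) by rewrite -[RHS]Lnorm_abse.
by rewrite lte_add_pinfty // normE.
Qed.

Lemma Lp_norm_gt0 (p : R) K q : 0 < p -> measurable (K : set (mR * mR)) ->
  measurable_fun (K : set (mR * mR)) (q : field) ->
  ~ {ae (@lebesgue2 R), forall x : R * R, K x -> q x = 0} ->
  (0 < Lp_norm p K q)%E.
Proof.
move=> p0 mK mq q0; rewrite lt0e Lnorm_ge0 andbT; apply/eqP => N0; apply: q0.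
have mQ : measurable_fun [set: mR * mR]
    (EFin \o ((euclid_norm \o q) \_ K) : mR * mR -> \bar R).
  by apply/measurable_EFinP; exact: measurable_norm_field.
have := Lnorm_eq0_eq0 mQ _ N0; rewrite lte_fin => /(_ p0).
apply: (@filterS _ _ ae2_filter) => x /= /(_ I) [+ Kx].
by rewrite patchE mem_set //; exact: euclid_norm_eq0.
Qed.

End Fields.

(** * Equivalence of the approximation error with a power of the dilation factor *)

Theorem theorem5p2 (R : realType) (p : R) (hp1 : 1 < p) (hp2 : p < 2)
    (K1 : set (R * R)) (hK1 : is_triangle K1) (h0 : closure K1 (0 : R * R))
    (q : R * R -> R * R) (hqLp : Lp_field p K1 q)
    (hscal : forall t : R, 0 < t -> t <= 1 ->
       {ae (@lebesgue2 R), forall x : R * R, K1 x -> q (t *: x) = t^-1 *: q x})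
    (hq0 : ~ {ae (@lebesgue2 R), forall x : R * R, K1 x -> q x = 0}) :
  exists c C : R, [/\ 0 < c, c <= C &
    forall h : R, 0 < h -> h <= 1 ->
      ((c * h `^ (2 / p - 1))%:E <= RT0_error p (dilate h K1) q)%E /\
      (RT0_error p (dilate h K1) q <= (C * h `^ (2 / p - 1))%:E)%E].
Proof.
have mK := triangle_measurable hK1.
have sK : star_shaped0 K1 by move=> t x; exact: triangle_star_shaped.
have mq := Lp_field_measurable mK hqLp.
have p1 := ltW hp1; have p0 : 0 < p by exact: lt_trans hp1.
have Ngt0 := Lp_norm_gt0 p0 mK mq hq0.
have Nlty := Lp_field_norm_lty p1 mK hqLp.
pose N := fine (Lp_norm p K1 q).
have NE : Lp_norm p K1 q = N%:E by rewrite fineK // ge0_fin_numE // ltW.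
have N0 : 0 < N by rewrite -lte_fin -NE.
pose M : R := 1 + 2^-1 `^ (- (2 / p)) + 4^-1 `^ (- (2 / p)).
have M1 : 1 <= M by rewrite /M -addrA lerDl addr_ge0 // powR_ge0.
have M0 : 0 < M by exact: lt_le_trans M1.
exists (N / M), N; split.
- exact: divr_gt0.
- by rewrite ler_pdivrMr // ler_peMr // ltW.
move=> h hh0 hh1; split.
- apply: le_ereal_inf_tmp => _ [tau tauRT <-].
  rewrite (Lp_norm_dilate_homogeneous p0 hh0 hh1 mK sK mq) //; last exact: hscal.
  rewrite mulrC EFinM lee_wpmul2l ?lee_fin ?powR_ge0 //.
  have := Lp_norm_le_RT0_distance p1 mK sK mq hscal (RT0_dilate tauRT).
  by rewrite NE -/M mulrC EFinM -lee_pdivrMl.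
- apply: ereal_inf_lbound; exists (fun=> 0).
    by exists 0, 0 => x _; rewrite scale0r addr0.
  rewrite (Lp_norm_dilate_homogeneous p0 hh0 hh1 mK sK mq) //; last 2 first.
  + exact: hscal.
  + by exists 0, 0 => x _; rewrite scale0r addr0.
  rewrite [N * _]mulrC EFinM -NE; congr (_ * Lp_norm _ _ _)%E.
  by apply/funext => x; rewrite scaler0 subr0.
Qed.
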